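(* Let $\{X_j\}_{j\in\mathbb Z}$ be a zero-mean, weakly stationary, purely nondeterministic process. Let $M$ be a finite set of integers with $0\notin M$, let $m,n\ge0$ be integers with $M\subset N:=\{-m,\dots,n\}$, and put $K=N\setminus(M\cup\{0\})$. Let $\{\varepsilon_{j,-m}\}_{j\ge -m}$ be the normalized innovations of $\{X_j\}_{j\ge-m}$ and $\{a_{k,j}\}$ the finite AR coefficients. Then the prediction error variance $\sigma^2(K)=\lVert X_0-\hat X_0(K)\rVert^2$ is $$\sigma^2(K)=\text{the }(0,0)\text{-entry of the inverse of }\Bigl(\sum_{k=\max(i,j)}^{n}\overline{a_{k-i,m+k}}\,a_{k-j,m+k}\Bigr)_{i,j\in M\cup\{0\}},$$ and the prediction error is $$X_0-\hat X_0(K)=\sum_{i\in M\cup\{0\}}\alpha'_i\Bigl(\sum_{k=i}^{n}\overline{a_{k-i,m+k}}\,\varepsilon_{k,-m}\Bigr),$$ where $(\alpha'_i)_{i\in M\cup\{0\}}$ is the solution of $\sum_{i\in M\cup\{0\}}\alpha'_i\gamma^{i,j}=\delta_{0j}$, $j\in M\cup\{0\}$, and $\gamma^{i,j}$ denotes the $(i,j)$-entry of $\Gamma^{-1}$, with $\Gamma=((X_i,X_j))_{i,j\in N}$ the covariance matrix of $(X_j)_{j\in N}$.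
   Context: All random variables are complex-valued, mean zero and in $L^2(\Omega,\mathcal F,P)$, with inner product $(U,V):=E[U\overline V]$ and norm $\lVert U\rVert:=E[|U|^2]^{1/2}$. For a finite set $K\subset\mathbb Z$, $\hat X_l(K)$ is the orthogonal projection of $X_l$ onto $\mathrm{sp}\{X_k;k\in K\}$ ($\mathrm{sp}\,\emptyset=\{0\}$). ''Purely nondeterministic'' means that $X_j\notin\overline{\mathrm{sp}}\{X_k;k<j\}$ and $X_j=\sum_{k=-\infty}^{j}b_{j-k}\varepsilon_k$ in mean square, where $\varepsilon_j$ is the normalized residual of projecting $X_j$ onto $\overline{\mathrm{sp}}\{X_k;k<j\}$ and $b_k=(X_0,\varepsilon_{-k})$. Finite innovations: for $m\ge0$, $\{\varepsilon_{j,-m}\}_{j\ge-m}$ is obtained from $\{X_j\}_{j\ge-m}$ by Gram–Schmidt: $\varepsilon_{-m,-m}:=X_{-m}/\lVert X_{-m}\rVert$ and $\varepsilon_{j,-m}:=(X_j-\hat X_j(\{-m,\dots,j-1\}))/\lVert X_j-\hat X_j(\{-m,\dots,j-1\})\rVert$ for $j>-m$. Finite MA coefficients: $b_{k,j}:=(X_j,\varepsilon_{j-k,0})$ for $0\le k\le j$. Finite AR coefficients $\{a_{k,j}\}_{0\le k\le j}$: defined by $\sum_{k=i}^{j}b_{j-k,j}\,a_{k-i,k}=\delta_{ij}$ for $0\le i\le j$. By stationarity, $X_j=\sum_{k=-m}^{j}b_{j-k,m+j}\varepsilon_{k,-m}$ and $\varepsilon_{j,-m}=\sum_{k=-m}^{j}a_{j-k,m+j}X_k$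 for $j\ge-m$. *)

(* Defs.v *)
From HB Require Import structures.
From mathcomp Require Import all_boot all_order all_algebra.
From mathcomp Require Import finmap.
From mathcomp Require Import all_classical all_reals all_analysis.
From mathcomp Require Import complex.

Set Implicit Arguments.
Unset Strict Implicit.
Unset Printing Implicit Defensive.

Import Order.TTheory GRing.Theory Num.Theory.
Import numFieldNormedType.Exports.

Local Open Scope classical_set_scope.
Local Open Scope ring_scope.
Local Open Scope complex_scope.

Section IntegerIndexing.

(* The integers k with i <= k <= j (empty when j < i). *)
Definition zint (i j : int) : {fset int} :=
  if i <= j then [fset (i + p%:Z)%R | p in iota 0 `|j - i|.+1]%fset else fset0.

Lemma in_zint (i j k : int) : (k \in zint i j) = (i <= k <= j).
Proof.
rewrite /zint; case: ifPn => [ij|]; last first.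
  rewrite inE -ltNge => ji; apply/esym/negbTE/negP => /andP[ik kj].
  by have := le_lt_trans (le_trans ik kj) ji; rewrite ltxx.
have memE p : (p \in iota 0 `|j - i|.+1) = (i + p%:Z <= j).
  by rewrite mem_iota leq0n ltnS -lez_nat gez0_abs ?subr_ge0 // lerBrDl.
apply/imfsetP/andP => [[p]|[ik kj]].
  by rewrite [in_mem _ _]memE => pij ->; rewrite lerDl.
exists `|k - i|%N; last by rewrite gez0_abs ?subr_ge0 // [i + _]addrC subrK.
by rewrite [in_mem _ _]memE gez0_abs ?subr_ge0 // [i + _]addrC subrK.
Qed.

Variable C : nzRingType.
Implicit Types (S : {fset int}) (F : int -> int -> C) (i j : int).

(* The matrix (F i j)_(i, j in S), whose rows and columns are numbered by an
   enumeration of S. *)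
Definition fsmx S F : 'M[C]_#|{: S}| :=
  \matrix_(p, q) F (fsval (enum_val p)) (fsval (enum_val q)).

(* The entry of A whose row and column are labelled by i, j in S (0 if one of
   the labels is not in S). *)
Definition fsmx_entry S (A : 'M[C]_#|{: S}|) i j : C :=
  if (insub i, insub j) is (Some p, Some q) then
    A (@enum_rank S p) (@enum_rank S q)
  else 0.

Lemma fsmxE S F i j : i \in S -> j \in S -> fsmx_entry (fsmx S F) i j = F i j.
Proof.
move=> iS jS; rewrite /fsmx_entry.
case: insubP => [p _ pE|]; last by rewrite iS.
case: insubP => [q _ qE|]; last by rewrite jS.
by rewrite mxE !enum_rankK; congr F.
Qed.

End IntegerIndexing.

Section L2.
Context (R : realType) (d : measure_display) (T : measurableType d).
Variable P : probability T R.
Implicit Types U V W : T -> R[i].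

(* U belongs to the complex space L^2(P). *)
Definition cL2 : set (T -> R[i]) :=
  [set U | (fun t => complex.Re (U t)) \in Lfun P 2%:E /\
           (fun t => complex.Im (U t)) \in Lfun P 2%:E].

Definition cexp U : R[i] :=
  (\int[P]_t complex.Re (U t))%R +i* (\int[P]_t complex.Im (U t))%R.

Definition inner U V : R[i] := cexp (fun t => U t * (V t)^*).

Definition L2norm U : R := Num.sqrt (complex.Re (inner U U)).

(* The orthogonal projection of U onto the linear subspace G, as a
   representative chosen in its class modulo almost sure equality. *)
Definition orth_proj (G : set (T -> R[i])) U : T -> R[i] :=
  xget (fun=> 0)
    [set V | G V /\ forall W, G W -> inner (fun t => U t - V t) W = 0].

(* The residual of U, divided by its norm. *)
Definition normalized_residual (G : set (T -> R[i])) U : T -> R[i] :=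
  fun t => (U t - orth_proj G U t) / (L2norm (fun s => U s - orth_proj G U s))%:C.

End L2.

Section Process.
Context (R : realType) (d : measure_display) (T : measurableType d).
Variables (P : probability T R) (X : int -> T -> R[i]).

Definition zero_mean_L2 := forall j, cL2 P (X j) /\ cexp P (X j) = 0.

Definition weakly_stationary :=
  forall i j h : int, inner P (X (i + h)) (X (j + h)) = inner P (X i) (X j).

(* sp {X_k; k in A}: finite linear combinations. *)
Definition sp (A : set int) : set (T -> R[i]) :=
  [set V | exists (K : {fset int}) (c : int -> R[i]),
     [set` K] `<=` A /\ V = (fun t => \sum_(k <- K) c k * X k t)].

(* The closure of sp {X_k; k in A} in L^2(P). *)
Definition csp (A : set int) : set (T -> R[i]) :=
  [set V | cL2 P V /\ forall e : R, 0 < e ->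
     exists W, sp A W /\ L2norm P (fun t => V t - W t) < e].

Definition innovation (j : int) : T -> R[i] :=
  normalized_residual P (csp [set k | k < j]) (X j).

Definition ma_coef (k : int) : R[i] := inner P (X 0) (innovation (- k)).

(* The series over k <= j is summed in the order k = j, j - 1, j - 2, etc. *)
Definition purely_nondeterministic :=
  forall j : int,
    ~ csp [set k | k < j] (X j) /\
    L2norm P (fun t => X j t -
        \sum_(k <- zint (j - N%:Z) j) ma_coef (j - k) * innovation k t)
      @[N --> \oo] --> (0 : R).

(* The predictor of X_l from (X_k)_(k in K). *)
Definition hatX (l : int) (K : {fset int}) : T -> R[i] :=
  orth_proj P (sp [set` K]) (X l).

(* fin_innovation m j is epsilon_{j,-m}, for j >= -m; when j = -m the span is
   {0}, so that it is X_{-m} / ||X_{-m}||. *)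
Definition fin_innovation (m j : int) : T -> R[i] :=
  normalized_residual P (sp [set` zint (- m) (j - 1)]) (X j).

(* fin_ma k j is b_{k,j}, for 0 <= k <= j. *)
Definition fin_ma (k j : int) : R[i] :=
  inner P (X j) (fin_innovation 0 (j - k)).

(* fin_ar k j is a_{k,j}; only its values for 0 <= k <= j are determined. *)
Definition fin_ar : int -> int -> R[i] :=
  xget (fun _ _ => 0)
    [set a | forall i j : int, 0 <= i -> i <= j ->
       \sum_(k <- zint i j) fin_ma (j - k) j * a (k - i) k = (i == j)%:R].

Definition covmx (N : {fset int}) : 'M[R[i]]_#|{: N}| :=
  fsmx N (fun i j => inner P (X i) (X j)).

End Process.

(* Main.v *)
Require Import Defs.
From HB Require Import structures.
From mathcomp Require Import all_boot all_order all_algebra.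
From mathcomp Require Import finmap.
From mathcomp Require Import all_classical all_reals all_analysis.
From mathcomp Require Import complex ring.

(** Put [Z_i = \sum_(k = i)^n conj(a_{k-i,m+k}) eps_{k,-m}]. Because the finite
    AR coefficients invert the finite MA coefficients
    [b_{j-k,m+j} = (X_j, eps_{k,-m})], the family [(Z_i)_(i in N)] is
    biorthogonal to [(X_j)_(j in N)]; as it lies in [sp {X_j; j in N}], its
    Gram matrix is the inverse of the covariance matrix, and orthonormality of
    the innovations computes that Gram matrix. If
    [\sum_(i in S) alpha_i gamma^{i,j} = delta_{0j}] for [j] in
    [S = M `|` {0}], then [E = \sum_(i in S) alpha_i Z_i] is orthogonal to
    [X_k] for [k] in [K], and in [X_0 - E] all the coefficients of the [X_j],
    [j] in [S], vanish; so [E] is the prediction error, with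
    [(E, E) = alpha_0].

    Pure nondeterminism makes the [X_j] linearly independent modulo null
    functions, so an element of a finite span is determined pointwise by its
    almost sure class: the chosen representatives of the projections are the
    expected linear combinations at every point. *)

Set Implicit Arguments.
Unset Strict Implicit.
Unset Printing Implicit Defensive.

Import Order.TTheory GRing.Theory Num.Theory.
Import numFieldNormedType.Exports.

Local Open Scope classical_set_scope.
Local Open Scope ring_scope.
Local Open Scope complex_scope.

(** * Sums and matrices indexed by finite sets of integers *)

Section IntegerIndexedSums.

Lemma big_fset_enum_val (C : nmodType) (S : {fset int}) (F : int -> C) :
  \sum_(i <- S) F i = \sum_(p < #|{: S}|) F (fsval (enum_val p)).
Proof.
rewrite big_seq_fsetE /=.
exact: (reindex _ (onW_bij _ (enum_val_bij S))).
Qed.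

Lemma big_zint_shift (C : nmodType) (i j h : int) (F : int -> C) :
  \sum_(k <- zint (i + h) (j + h)) F k = \sum_(k <- zint i j) F (k + h).
Proof.
have -> : zint (i + h) (j + h) = [fset (k + h)%R | k in zint i j]%fset.
  apply/fsetP => k; rewrite in_zint; apply/idP/imfsetP => [ikj|[l]].
    by exists (k - h); rewrite ?subrK //= in_zint lerBrDr lerBlDr.
  by rewrite /= in_zint => ilj ->; rewrite !lerD2r.
by rewrite big_imfset //= => x y _ _ /addIr.
Qed.

Lemma big_fset_delta (C : nzSemiRingType) (S : {fset int}) (F : int -> C) i :
  i \in S -> \sum_(k <- S) (i == k)%:R * F k = F i.
Proof.
move=> iS; rewrite (big_fsetD1 i) //= eqxx mul1r big1_seq ?addr0 // => k.
by rewrite in_fsetD1 eq_sym => /= /andP[/negbTE -> _]; rewrite mul0r.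
Qed.

Variable C : nzRingType.
Implicit Types (S : {fset int}) (F G : int -> int -> C).

Lemma eq_fsmx S F G :
  (forall i j, i \in S -> j \in S -> F i j = G i j) <-> fsmx S F = fsmx S G.
Proof.
split=> [FG|FG i j iS jS]; last by rewrite -(fsmxE F iS jS) FG fsmxE.
by apply/matrixP => p q; rewrite !mxE FG // fsvalP.
Qed.

Lemma fsmx_entryK S (A : 'M[C]_#|{: S}|) : fsmx S (fsmx_entry A) = A.
Proof.
apply/matrixP => p q; rewrite mxE /fsmx_entry.
by rewrite !valK !enum_valK.
Qed.

Lemma fsmx_mul S F G :
  fsmx S F *m fsmx S G = fsmx S (fun i j => \sum_(k <- S) F i k * G k j).
Proof.
apply/matrixP => p q; rewrite !mxE big_fset_enum_val.
by apply: eq_bigr => r _; rewrite !mxE.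
Qed.

Lemma fsmx1 S : fsmx S (fun i j => (i == j)%:R) = 1%:M :> 'M[C]_#|{: S}|.
Proof.
apply/matrixP => p q; rewrite !mxE; congr (_%:R).
by rewrite (inj_eq val_inj) (inj_eq enum_val_inj).
Qed.

End IntegerIndexedSums.

(** A one-sided inverse of a square matrix over a commutative ring is two-sided. This will turn left
    inverses of the MA matrix and of a Gram matrix into right inverses. *)
Lemma fsmx_mul1C (C : comNzRingType) (S : {fset int}) (F G : int -> int -> C) :
  (forall i j, i \in S -> j \in S ->
    \sum_(k <- S) F i k * G k j = (i == j)%:R) ->
  forall i j, i \in S -> j \in S ->
    \sum_(k <- S) G i k * F k j = (i == j)%:R.
Proof.
move=> FG.
apply/(eq_fsmx S (fun i j => \sum_(k <- S) G i k * F k j)).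
rewrite -fsmx_mul fsmx1; apply: mulmx1C.
by rewrite fsmx_mul -fsmx1; apply/eq_fsmx.
Qed.

(** * The complex space [cL2] and its inner product *)

Section L2Theory.
Context (R : realType) (d : measure_display) (T : measurableType d).
Variable P : probability T R.
Implicit Types U V W : T -> R[i].

Lemma eq_Lfun (p : \bar R) (f g : T -> R) :
  f =1 g -> f \in Lfun P p -> g \in Lfun P p.
Proof. by move=> /funext ->. Qed.

Lemma Lfun_lincomb (p : R) (a b : R) (f g : T -> R) : 1 <= p ->
  f \in Lfun P p%:E -> g \in Lfun P p%:E ->
  (fun t => a * f t + b * g t) \in Lfun P p%:E.
Proof.
move=> p1 fp gp; have p1' : (1 <= p%:E)%E by rewrite lee_fin.
have [L0 Llin] := Lfun_submod_closed P p1'.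
have bgp := Llin b g 0 gp L0; apply: eq_Lfun (Llin a f _ fp bgp).
by move=> t /=; rewrite addr0.
Qed.

Lemma cL2_0 : cL2 P (fun=> 0).
Proof.
have p1 : (1 <= 2%:E :> \bar R)%E by rewrite lee_fin ler1n.
by split; exact: (Lfun_submod_closed P p1).1.
Qed.

Lemma cL2D U V : cL2 P U -> cL2 P V -> cL2 P (fun t => U t + V t).
Proof.
move=> [U1 U2] [V1 V2]; split.
- apply: eq_Lfun (Lfun_lincomb 1 1 (ler1n _ 2) U1 V1) => t /=.
  by rewrite !mul1r; case: (U t) (V t) => [? ?] [? ?].
- apply: eq_Lfun (Lfun_lincomb 1 1 (ler1n _ 2) U2 V2) => t /=.
  by rewrite !mul1r; case: (U t) (V t) => [? ?] [? ?].
Qed.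

Lemma cL2Z c U : cL2 P U -> cL2 P (fun t => c * U t).
Proof.
move=> [U1 U2]; case: c => x y; split.
- apply: eq_Lfun (Lfun_lincomb x (- y) (ler1n _ 2) U1 U2) => t /=.
  by case: (U t) => [? ?]; rewrite mulNr.
- apply: eq_Lfun (Lfun_lincomb x y (ler1n _ 2) U2 U1) => t /=.
  by case: (U t) => [? ?].
Qed.

Lemma cL2_sum (I : Type) (r : seq I) (c : I -> R[i]) (U : I -> T -> R[i]) :
  (forall i, cL2 P (U i)) -> cL2 P (fun t => \sum_(i <- r) c i * U i t).
Proof.
move=> UL2; elim: r => [|i r IHr].
  by under eq_fun do rewrite big_nil; exact: cL2_0.
by under eq_fun do rewrite big_cons; apply: cL2D IHr; exact: cL2Z.
Qed.

(** A class on which [cexp] is linear; by Hölder it contains the products formed in [inner]. *)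
Definition cintegrable U :=
  (fun t => complex.Re (U t)) \in Lfun P 1 /\
  (fun t => complex.Im (U t)) \in Lfun P 1.

Lemma cintegrable_inner U V :
  cL2 P U -> cL2 P V -> cintegrable (fun t => U t * (V t)^*).
Proof.
move=> [U1 U2] [V1 V2]; split.
- apply: eq_Lfun (Lfun_lincomb 1 1 (lexx 1) (Lfun2_mul_Lfun1 U1 V1)
    (Lfun2_mul_Lfun1 U2 V2)) => t /=.
  by rewrite !mul1r; case: (U t) (V t) => [? ?] [? ?] /=; rewrite mulrN opprK.
- apply: eq_Lfun (Lfun_lincomb 1 (- 1) (lexx 1) (Lfun2_mul_Lfun1 U2 V1)
    (Lfun2_mul_Lfun1 U1 V2)) => t /=.
  rewrite mulN1r mul1r; case: (U t) (V t) => [? ?] [? ?] /=.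
  by rewrite mulrN addrC.
Qed.

Lemma cexpD U V : cintegrable U -> cintegrable V ->
  cexp P (fun t => U t + V t) = cexp P U + cexp P V.
Proof.
move=> [/Lfun1_integrable U1 /Lfun1_integrable U2].
move=> [/Lfun1_integrable V1 /Lfun1_integrable V2].
rewrite /cexp; apply/eqP; rewrite eq_complex /= -!RintegralD //.
by apply/andP; split; apply/eqP; apply: eq_Rintegral => t _ /=;
  case: (U t) (V t) => [? ?] [? ?].
Qed.

Lemma cexpZ c U : cintegrable U -> cexp P (fun t => c * U t) = c * cexp P U.
Proof.
have intZ z f : f \in Lfun P 1 ->
    P.-integrable setT (EFin \o (fun t => z * f t)).
  move=> f1; apply/Lfun1_integrable.
  by apply: eq_Lfun (Lfun_lincomb z 0 (lexx 1) f1 f1) => t; rewrite mul0r addr0.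
move=> [U1 U2]; case: c => x y.
have [iU1 iU2] := (proj1 (Lfun1_integrable _ _) U1, proj1 (Lfun1_integrable _ _) U2).
rewrite /cexp; apply/eqP; rewrite eq_complex /= -!RintegralZl //.
rewrite -RintegralB ?intZ // -RintegralD ?intZ //.
by apply/andP; split; apply/eqP; apply: eq_Rintegral => t _ /=;
  case: (U t) => [? ?].
Qed.

Lemma innerDl U V W : cL2 P U -> cL2 P V -> cL2 P W ->
  inner P (fun t => U t + V t) W = inner P U W + inner P V W.
Proof.
move=> UL2 VL2 WL2; rewrite /inner -cexpD; try exact: cintegrable_inner.
by congr cexp; apply/funext => t; rewrite mulrDl.
Qed.

Lemma innerZl c U W : cL2 P U -> cL2 P W ->
  inner P (fun t => c * U t) W = c * inner P U W.
Proof.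
move=> UL2 WL2; rewrite /inner -cexpZ; last exact: cintegrable_inner.
by congr cexp; apply/funext => t; rewrite mulrA.
Qed.

(* [%R] selects [Num.conj], the conjugation that occurs inside products (as in
   [inner]); in [complex_scope] the notation would denote [conjc]. *)
Lemma inner_conj U V : cL2 P U -> cL2 P V -> inner P V U = (inner P U V)^*%R.
Proof.
move=> UL2 VL2; have [_ /Lfun1_integrable UV2] := cintegrable_inner UL2 VL2.
rewrite /inner /cexp; apply/eqP; rewrite eq_complex /= -mulN1r -RintegralZl //.
apply/andP; split; apply/eqP; apply: eq_Rintegral => t _ /=;
  case: (U t) (V t) => [? ?] [? ?] /=; ring.
Qed.

Lemma inner_ge0 U : 0 <= inner P U U.
Proof.
rewrite lecE /=; apply/andP; split.
  rewrite (@eq_Rintegral _ _ _ _ _ (cst 0)) ?Rintegral_cst ?mul0r // => t _.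
  by case: (U t) => ? ? /=; ring.
apply: Rintegral_ge0 => t _; case: (U t) => x y /=.
by rewrite mulrN opprK addr_ge0 // -expr2 sqr_ge0.
Qed.

Lemma innerZZ c U : cL2 P U ->
  inner P (fun t => c * U t) (fun t => c * U t) = c * c^* * inner P U U.
Proof.
move=> UL2; rewrite innerZl //; last exact: cL2Z.
rewrite inner_conj ?innerZl //; last exact: cL2Z.
by rewrite rmorphM /= -inner_conj // mulrA.
Qed.

Lemma sqr_L2norm U : (L2norm P U ^+ 2)%:C = inner P U U.
Proof.
have U0 := inner_ge0 U; rewrite sqr_sqrtr ?RRe_real ?ger0_real //.
by move: U0; rewrite lecE => /andP[].
Qed.

Lemma L2norm_eq0 U : (L2norm P U == 0) = (inner P U U == 0).
Proof. by rewrite -sqr_L2norm fmorph_eq0 sqrf_eq0. Qed.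

Lemma inner_suml (I : Type) (r : seq I) (c : I -> R[i]) (U : I -> T -> R[i]) W :
  (forall i, cL2 P (U i)) -> cL2 P W ->
  inner P (fun t => \sum_(i <- r) c i * U i t) W
  = \sum_(i <- r) c i * inner P (U i) W.
Proof.
move=> UL2 WL2; elim: r => [|i r IHr].
  under eq_fun do rewrite big_nil.
  have := innerZl 0 cL2_0 WL2; by rewrite big_nil !mul0r.
under eq_fun do rewrite big_cons.
rewrite big_cons innerDl //; [|exact: cL2Z|exact: cL2_sum].
by rewrite innerZl // IHr.
Qed.

Lemma inner_sumr (I : Type) (r : seq I) (c : I -> R[i]) (U : I -> T -> R[i]) W :
  (forall i, cL2 P (U i)) -> cL2 P W ->
  inner P W (fun t => \sum_(i <- r) c i * U i t)
  = \sum_(i <- r) (c i)^* * inner P W (U i).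
Proof.
move=> UL2 WL2; rewrite inner_conj //; last exact: cL2_sum.
rewrite inner_suml // rmorph_sum; apply: eq_bigr => i _.
by rewrite rmorphM /= -inner_conj.
Qed.

Lemma innerBl U V W : cL2 P U -> cL2 P V -> cL2 P W ->
  inner P (fun t => U t - V t) W = inner P U W - inner P V W.
Proof.
move=> UL2 VL2 WL2; rewrite -mulN1r -innerZl // -innerDl //; last exact: cL2Z.
by congr (inner P _ _); apply/funext => t; rewrite mulN1r.
Qed.

Lemma cL2B U V : cL2 P U -> cL2 P V -> cL2 P (fun t => U t - V t).
Proof.
move=> UL2 /(cL2Z (-1)) /(cL2D UL2).
by under eq_fun do rewrite mulN1r.
Qed.

End L2Theory.

(** * Projections onto finite spans and the normal equations *)

Section Projection.
Context (R : realType) (d : measure_display) (T : measurableType d).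
Variable P : probability T R.
Implicit Types (X Y : int -> T -> R[i]) (K : {fset int}) (c : int -> R[i]).

Definition lincomb X K c : T -> R[i] := fun t => \sum_(k <- K) c k * X k t.

(** Linear independence of the [X k], [k] in [K], modulo null functions; equivalently, their Gram
    matrix is positive definite. *)
Definition definite_on X K := forall c,
  inner P (lincomb X K c) (lincomb X K c) = 0 -> forall k, k \in K -> c k = 0.

Lemma cL2_lincomb X K c : (forall j, cL2 P (X j)) -> cL2 P (lincomb X K c).
Proof. by move=> X_L2; exact: cL2_sum. Qed.

Lemma eq_lincomb X K c1 c2 :
  {in K, c1 =1 c2} -> lincomb X K c1 = lincomb X K c2.
Proof.
by move=> c12; apply/funext => t; apply: eq_big_seq => k kK; rewrite c12.
Qed.

Lemma lincombB X K c1 c2 t :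
  lincomb X K (fun k => c1 k - c2 k) t = lincomb X K c1 t - lincomb X K c2 t.
Proof. by rewrite -sumrB; apply: eq_bigr => k _; rewrite mulrBl. Qed.

Lemma lincombZ X K a c t :
  lincomb X K (fun k => a * c k) t = a * lincomb X K c t.
Proof. by rewrite mulr_sumr; apply: eq_bigr => k _; rewrite mulrA. Qed.

Lemma lincomb_sum X K (r : seq int) (a : int -> R[i]) (c : int -> int -> R[i]) t :
  lincomb X K (fun k => \sum_(i <- r) a i * c i k) t
  = \sum_(i <- r) a i * lincomb X K (c i) t.
Proof.
rewrite /lincomb; under [RHS]eq_bigr do rewrite mulr_sumr.
rewrite exchange_big; apply: eq_bigr => k _; rewrite mulr_suml.
by apply: eq_bigr => i _; rewrite mulrA.
Qed.

Lemma lincomb_incl X K1 K2 c : (K1 `<=` K2)%fset ->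
  (forall k, k \in K2 -> k \notin K1 -> c k = 0) ->
  lincomb X K1 c = lincomb X K2 c.
Proof.
move=> K12 c0; apply/funext => t; apply: big_fset_incl => // k k2 k1.
by rewrite c0 // mul0r.
Qed.

Lemma lincomb_delta X K k t : k \in K ->
  lincomb X K (fun l => (k == l)%:R) t = X k t.
Proof. exact: big_fset_delta. Qed.

(** Coefficients on a smaller index set extend by zero, so [K] itself can serve as the index set of
    every element of its span. *)
Lemma sp_fsetP X K V : sp X [set` K] V <-> exists c, V = lincomb X K c.
Proof.
split=> [[K' [c [K'K ->]]]|[c ->]]; last by exists K, c; split.
exists (fun k => if k \in K' then c k else 0).
rewrite -(@lincomb_incl X K' K).
- by apply: eq_lincomb => k /= ->.
- by apply/fsubsetP => k /K'K.
- by move=> k _ /negbTE ->.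
Qed.

(** A row vector in the left kernel gives a combination orthogonal to every [X j], [j] in [K], hence
    to itself; definiteness then makes it zero. *)
Lemma gram_unitmx X K : (forall j, cL2 P (X j)) -> definite_on X K ->
  fsmx K (fun i j => inner P (X i) (X j)) \in unitmx.
Proof.
move=> X_L2 X_def; rewrite -row_free_unit -kermx_eq0; apply/rowV0P => v.
move=> /sub_kermxP vG.
pose c i := if insub i is Some p then v 0 (@enum_rank K p) else 0.
have cE p : c (fsval (enum_val p)) = v 0 p by rewrite /c valK enum_valK.
apply/rowP => p; rewrite mxE -cE; apply: X_def (fsvalP _).
rewrite inner_sumr //; last exact: cL2_lincomb.
rewrite big1_seq // => j /= jK; rewrite inner_suml // big_fset_enum_val.
have /rowP /(_ (enum_rank [` jK]%fset)) := vG; rewrite !mxE => vGj.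
rewrite [X in _ * X](_ : _ = 0) ?mulr0 // -[RHS]vGj.
by apply: eq_bigr => q _; rewrite mxE cE enum_rankK.
Qed.

(** Definiteness makes the solution of the normal equations unique on [K], so the representative
    picked by [xget] is this very function, not only a member of its almost sure class. *)
Lemma orth_proj_lincomb X K U c :
  (forall j, cL2 P (X j)) -> definite_on X K -> cL2 P U ->
  (forall k, k \in K -> inner P (fun t => U t - lincomb X K c t) (X k) = 0) ->
  orth_proj P (sp X [set` K]) U = lincomb X K c.
Proof.
move=> X_L2 X_def U_L2 Uc.
have cL2U e : cL2 P (fun t => U t - lincomb X K e t).
  by apply: cL2B => //; exact: cL2_lincomb.
have Uc_sp W : sp X [set` K] W -> inner P (fun t => U t - lincomb X K c t) W = 0.
  move=> /sp_fsetP[e ->]; rewrite inner_sumr // big1_seq // => k /= kK.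
  by rewrite Uc // mulr0.
apply: xget_unique => [|_ [/sp_fsetP[e ->] Ue]].
  by split=> //; apply/sp_fsetP; exists c.
apply: eq_lincomb => k kK; apply/eqP; rewrite -subr_eq0; apply/eqP.
apply: (X_def (fun k => e k - c k)) => //.
(* The difference of two candidates is also the difference of their residuals, both orthogonal to
   the span; hence it is orthogonal to itself. *)
set D := lincomb X K _.
have D_sp : sp X [set` K] D by apply/sp_fsetP; exists (fun k => e k - c k).
have DE : D = fun t => (U t - lincomb X K c t) - (U t - lincomb X K e t).
  by apply/funext => t; rewrite /D lincombB; ring.
rewrite {1}DE innerBl //; first by rewrite Uc_sp // Ue // subr0.
exact: cL2_lincomb.
Qed.

(** The Gram matrix is invertible: the row of inner products of [U] with the [X i], multiplied by
    the inverse [H], solves the equations. *)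
Lemma normal_equations X K U :
  (forall j, cL2 P (X j)) -> definite_on X K -> cL2 P U ->
  exists c, forall k, k \in K ->
    inner P (fun t => U t - lincomb X K c t) (X k) = 0.
Proof.
move=> X_L2 X_def U_L2; have Gu := gram_unitmx X_L2 X_def.
pose G i j := inner P (X i) (X j); pose H := fsmx_entry (invmx (fsmx K G)).
have HG : forall i j, i \in K -> j \in K ->
    \sum_(k <- K) H i k * G k j = (i == j)%:R.
  apply/(eq_fsmx K (fun i j => \sum_(k <- K) H i k * G k j)).
  by rewrite -fsmx_mul fsmx1 fsmx_entryK mulVmx.
exists (fun k => \sum_(i <- K) inner P U (X i) * H i k) => j jK.
rewrite innerBl //; last exact: cL2_lincomb.
rewrite inner_suml //; under eq_bigr do rewrite mulr_suml.
rewrite exchange_big /=; under eq_big_seq => i iK.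
  under eq_bigr do rewrite -mulrA.
  rewrite -mulr_sumr HG // mulrC eq_sym.
  over.
by rewrite big_fset_delta // subrr.
Qed.

End Projection.

(** * Finite innovations, MA and AR coefficients *)

Section FiniteInnovations.
Context (R : realType) (d : measure_display) (T : measurableType d).
Variables (P : probability T R) (X : int -> T -> R[i]).
Hypothesis X_L2 : zero_mean_L2 P X.
Hypothesis X_stat : weakly_stationary P X.
Hypothesis X_notin : forall j, ~ csp P X [set k | k < j] (X j).
Implicit Types (K : {fset int}) (c : int -> R[i]).

Let X_cL2 j : cL2 P (X j). Proof. by case: (X_L2 j). Qed.

Let Xs (h k : int) := X (k + h).

Let Xs_cL2 h j : cL2 P (Xs h j). Proof. exact: X_cL2. Qed.

(* In a null linear combination, the [X_k] with the largest index having a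
   nonzero coefficient would lie in the closed span of its past. *)
Lemma process_definite K : definite_on P X K.
Proof.
move=> c Xc0 k0 k0K; apply/eqP/negPn/negP => ck0.
pose Q := [pred p : K | c (fsval p) != 0].
have Qk0 : Q [` k0K]%fset by [].
case: (@Order.TotalTheory.arg_maxP _ _ _ _ Q (fun p => fsval p) Qk0) => p /= cp pmax.
set k := fsval p in cp pmax.
have kK : k \in K := fsvalP p.
have kmax l : l \in K -> k < l -> c l = 0.
  move=> lK kl; apply/eqP/negPn/negP => cl.
  by have := pmax [` lK]%fset cl; rewrite leNgt kl.
apply: (X_notin (j := k)); split=> // e e0.
(* The remaining terms, divided by [- c k], approximate [X k] with error zero: the difference is the
   null combination divided by [c k]. *)
exists (lincomb X [fset l in K | l < k]%fset (fun l => - (c k)^-1 * c l)); split.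
  exists [fset l in K | l < k]%fset, (fun l => - (c k)^-1 * c l); split => // l.
  by rewrite /= !inE => /andP[].
rewrite (_ : (fun t => _) = fun t => (c k)^-1 * lincomb X K c t).
  have : L2norm P (fun t => (c k)^-1 * lincomb X K c t) == 0.
    by rewrite L2norm_eq0 innerZZ ?Xc0 ?mulr0 //; exact: cL2_lincomb.
  by move=> /eqP ->.
apply/funext => t; rewrite lincombZ mulNr opprK.
have -> : lincomb X K c t = c k * X k t + lincomb X [fset l in K | l < k]%fset c t.
  rewrite {1}/lincomb (big_fsetD1 k) //=; congr (_ + _).
  apply/esym/big_fset_incl => [|l]; first apply/fsubsetP => l.
    by rewrite !inE => /andP[-> lk]; rewrite andbT lt_eqF.
  rewrite !inE => /andP[lk lK]; rewrite lK /= -leNgt le_eqVlt eq_sym (negbTE lk) /=.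
  by move=> kl; rewrite kmax // mul0r.
by rewrite mulrDr mulrA mulVf // mul1r.
Qed.

Lemma inner_lincomb_shift h K K' c c' :
  inner P (lincomb (Xs h) K c) (lincomb (Xs h) K' c')
  = inner P (lincomb X K c) (lincomb X K' c').
Proof.
rewrite !inner_suml //; try exact/cL2_lincomb.
apply: eq_bigr => k _; congr (_ * _); rewrite !inner_sumr //.
by apply: eq_bigr => l _; congr (_ * _); exact: X_stat.
Qed.

Lemma sp_shift h i j :
  sp X [set` zint (i + h) (j + h)] = sp (Xs h) [set` zint i j].
Proof.
apply/seteqP; split=> V /sp_fsetP[c ->]; apply/sp_fsetP.
  exists (fun k => c (k + h)); apply/funext => t; exact: big_zint_shift.
exists (fun k => c (k - h)); apply/funext => t.
rewrite /lincomb big_zint_shift; apply: eq_bigr => k _.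
by rewrite addrK.
Qed.

(* By stationarity the coefficients [c] do not depend on the shift [h]. *)
Lemma fin_innovationE p k : - p <= k -> exists c,
  [/\ forall h, fin_innovation P X (p - h) (k + h)
        = lincomb (Xs h) (zint (- p) k) c,
      forall l, - p <= l < k ->
        inner P (lincomb X (zint (- p) k) c) (X l) = 0
    & inner P (lincomb X (zint (- p) k) c) (lincomb X (zint (- p) k) c) = 1].
Proof.
move=> pk; set J := zint (- p) k; set I := zint (- p) (k - 1).
have kJ : k \in J by rewrite in_zint pk lexx.
have [b bP] := normal_equations X_cL2 (process_definite (K := I)) (X_cL2 k).
(* These are the coefficients of the residual of [X k]. Outside [I] the values of [b] are arbitrary;
   the one at [k] is discarded, so that [c k = 1]. *)
pose c l := (k == l)%:R - (if l == k then 0 else b l).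
have resE h t : Xs h k t - lincomb (Xs h) I b t = lincomb (Xs h) J c t.
  rewrite /c lincombB lincomb_delta //; congr (_ - _).
  have IJ : (I `<=` J)%fset.
    apply/fsubsetP => l; rewrite !in_zint => /andP[-> lk] /=.
    by rewrite (le_trans lk) // gerBl.
  rewrite -(lincomb_incl _ IJ) => [|l].
    apply: (congr1 (fun f => f t)); apply: eq_lincomb => l; rewrite in_zint.
    by move=> /andP[_]; rewrite -[_ <= k - 1]ltzD1 subrK => /lt_eqF ->.
  rewrite !in_zint; case: eqP => // /eqP lk /andP[-> /=]; rewrite le_eqVlt (negbTE lk) /=.
  by rewrite -[_ <= k - 1]ltzD1 subrK => ->.
have res0 : (fun t => X k t - lincomb X I b t) = lincomb X J c.
  apply/funext => t; have := resE 0 t; rewrite /Xs addr0.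
  by have -> : (fun k => X (k + 0)) = X by apply/funext => l; rewrite addr0.
(* The past window of [k + h] is [I] shifted by [h], and by stationarity the same [b] solves the
   shifted normal equations. *)
have proj h : orth_proj P (sp X [set` zint (- (p - h)) (k + h - 1)]) (X (k + h))
    = lincomb (Xs h) I b.
  rewrite opprB addrC addrAC sp_shift.
  apply: orth_proj_lincomb => // [e|l lI].
    rewrite inner_lincomb_shift; exact: process_definite.
  rewrite (_ : (fun t => _) = lincomb (Xs h) J c); last exact/funext/resE.
  rewrite -(bP l lI) res0 !inner_suml //.
  by apply: eq_bigr => j _; congr (_ * _); exact: X_stat.
pose r := L2norm P (lincomb X J c).
(* A null residual would force [c k = 0], whereas [c k = 1]. *)
have r0 : r != 0.
  rewrite L2norm_eq0; apply/eqP => /process_definite /(_ k kJ).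
  by rewrite /c !eqxx subr0 => /eqP; rewrite oner_eq0.
have rE : (fun t => r%:C^-1 * lincomb X J c t) = lincomb X J (fun l => r%:C^-1 * c l).
  by apply/funext => t; rewrite lincombZ.
have JcL2 := cL2_lincomb J c X_cL2.
exists (fun l => r%:C^-1 * c l); split=> [h|l lk|].
- apply/funext => t; rewrite lincombZ mulrC /fin_innovation /normalized_residual proj.
  have -> : (fun s => X (k + h) s - lincomb (Xs h) I b s) = lincomb (Xs h) J c.
    by apply/funext => s; exact: resE.
  by rewrite resE /L2norm inner_lincomb_shift.
- rewrite -rE innerZl // -res0 bP ?mulr0 // in_zint.
  by rewrite -[_ <= k - 1]ltzD1 subrK.
rewrite -rE innerZZ // -sqr_L2norm -/r.
have -> : r%:C^-1 = r^-1%:C by rewrite fmorphV.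
have -> : (r^-1%:C)^*%R = r^-1%:C by exact: conjc_real.
by rewrite -!rmorphM /= -mulrA expr2 mulKf // mulVf.
Qed.

(** By [fin_innovationE] both innovations have the same coefficients, up to the shift of the
    process; stationarity does the rest. *)
Lemma fin_innovation_shift p k h j : - p <= k ->
  inner P (X (j + h)) (fin_innovation P X (p - h) (k + h))
  = inner P (X j) (fin_innovation P X p k).
Proof.
move=> /fin_innovationE[c [cE _ _]]; rewrite cE.
have := cE 0; rewrite subr0 !addr0 => ->.
rewrite !inner_sumr //; apply: eq_bigr => l _; congr (_ * _).
by rewrite /Xs addr0; exact: X_stat.
Qed.

Lemma fin_innovation_lincomb p k : - p <= k ->
  exists c, fin_innovation P X p k = lincomb X (zint (- p) k) c.
Proof.
move=> /fin_innovationE[c [/(_ 0)]]; rewrite subr0 addr0 => -> _ _.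
by exists c; congr lincomb; apply/funext => l; rewrite /Xs addr0.
Qed.

(** Stated for every [k] because [inner_suml], [inner_sumr] and [cL2_sum] ask for [cL2] at all
    indices; for [k <= - p] the window [I] is empty. *)
Lemma fin_innovation_cL2 p k : cL2 P (fin_innovation P X p k).
Proof.
set I := zint (- p) (k - 1).
have [b bP] := normal_equations X_cL2 (process_definite (K := I)) (X_cL2 k).
rewrite /fin_innovation /normalized_residual.
rewrite (orth_proj_lincomb X_cL2 (process_definite (K := I)) _ bP) //.
under eq_fun do rewrite mulrC.
by apply: cL2Z; apply: cL2B => //; exact: cL2_lincomb.
Qed.

Lemma fin_innovation_orth p k l : - p <= l < k ->
  inner P (X l) (fin_innovation P X p k) = 0.
Proof.
move=> /andP[pl lk]; have pk := le_trans pl (ltW lk).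
rewrite inner_conj //; last exact: fin_innovation_cL2.
have [c [/(_ 0) + corth _]] := fin_innovationE pk.
rewrite subr0 addr0 => ->.
have -> : Xs 0 = X by apply/funext => i; rewrite /Xs addr0.
by rewrite corth ?rmorph0 // pl.
Qed.

(** For [k < l] the innovation at [k] combines [X i] with [i <= k], each orthogonal to the
    innovation at [l]; conjugation gives the other order. *)
Lemma fin_innovation_orthonormal p k l : - p <= k -> - p <= l ->
  inner P (fin_innovation P X p k) (fin_innovation P X p l) = (k == l)%:R.
Proof.
move=> pk pl; wlog kl : k l pk pl / k <= l => [hwlog|].
  have [/hwlog->//|/ltW lk] := leP k l.
  rewrite inner_conj ?hwlog ?rmorph_nat //; try exact: fin_innovation_cL2.
  by rewrite eq_sym.
have [->{k pk kl}|neq_kl] := eqVneq k l.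
  have [c [/(_ 0) + _ c1]] := fin_innovationE pl.
  rewrite subr0 addr0 => ->; rewrite -[RHS]c1.
  by have -> : Xs 0 = X by apply/funext => i; rewrite /Xs addr0.
have [c ->] := fin_innovation_lincomb pk.
rewrite inner_suml //; last exact: fin_innovation_cL2.
rewrite big1_seq // => i; rewrite /= in_zint => /andP[pi ik].
rewrite fin_innovation_orth ?mulr0 // pi (le_lt_trans ik) //.
by rewrite lt_neqAle neq_kl.
Qed.

(** The coefficients [fin_ma] come from innovations started at time 0; a shift by [p] relates them
    to those started at [- p]. *)
Lemma fin_ma_innovation p j k : - p <= k ->
  fin_ma P X (j - k) (p + j) = inner P (X j) (fin_innovation P X p k).
Proof.
move=> pk; rewrite -(fin_innovation_shift p j pk) /fin_ma subrr.
have -> : p + j - (j - k) = k + p by ring.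
by rewrite [p + j]addrC.
Qed.

(* The coefficients of the innovations form a left inverse of the
   lower-triangular matrix of the finite MA coefficients, hence also a right
   inverse. *)
Lemma fin_arP i j : 0 <= i -> i <= j ->
  \sum_(k <- zint i j) fin_ma P X (j - k) j * fin_ar P X (k - i) k
  = (i == j)%:R.
Proof.
pose e := fin_innovation P X 0.
pose solution (a : int -> int -> R[i]) := forall i j, 0 <= i -> i <= j ->
  \sum_(k <- zint i j) fin_ma P X (j - k) j * a (k - i) k = (i == j)%:R.
(* Since [fin_ar] is chosen by [xget], it solves the system as soon as some solution exists. *)
suff [a a_sol] : exists a, solution a.
  by move: i j; apply: (@xgetPex _ _ solution); exists a.
have eP k : exists c, 0 <= k -> e k = lincomb X (zint 0 k) c.
  have [k0|] := boolP (0 <= k); last by exists (fun=> 0).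
  have := @fin_innovation_lincomb 0 k; rewrite oppr0 => /(_ k0)[c cE].
  by exists c.
(* The witness takes [a p k] to be the coefficient of [X (k - p)] in [e k]. *)
have [c cE] := choice eP; exists (fun p k => c k (k - p)) => {}i {}j i0 ij.
(* [D] is the coefficient matrix of the innovations, cut to zero above the diagonal, where [c] is
   arbitrary; [B] holds the MA coefficients. *)
pose D k l := if l <= k then c k l else 0.
pose B l k := inner P (X l) (e k).
have j0 : 0 <= j := le_trans i0 ij.
have B0 l k : 0 <= l < k -> B l k = 0.
  by move=> lk; rewrite /B fin_innovation_orth // oppr0.
(* The product of [D] and [B] expands the inner products of the orthonormal family [e]. *)
have DB k l : k \in zint 0 j -> l \in zint 0 j ->
    \sum_(q <- zint 0 j) D k q * B q l = (k == l)%:R.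
  rewrite !in_zint => /andP[k0 kj] /andP[l0 lj].
  have [ek el] : - 0 <= k /\ - 0 <= l by rewrite oppr0.
  rewrite -(fin_innovation_orthonormal ek el) -/(e k) cE // inner_suml //.
    have kjS : (zint 0 k `<=` zint 0 j)%fset.
      apply/fsubsetP => q; rewrite !in_zint => /andP[-> qk].
      by rewrite (le_trans qk).
    rewrite -(big_fset_incl _ kjS) /= => [|q]; last first.
      rewrite !in_zint => /andP[-> _] /= /negbTE qk.
      by rewrite /D qk mul0r.
    by apply: eq_big_seq => q; rewrite in_zint /D => /andP[_ ->].
  exact: fin_innovation_cL2.
(* The goal is the entry [(j, i)] of [B] times [D]; the terms with [q < i] vanish because [D] is
   triangular. *)
have := fsmx_mul1C DB (i := j) (j := i).
rewrite !in_zint j0 i0 ij lexx => /(_ isT isT); rewrite eq_sym => <-.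
have ijS : (zint i j `<=` zint 0 j)%fset.
  by apply/fsubsetP => q; rewrite !in_zint => /andP[/(le_trans i0) -> ->].
rewrite -(big_fset_incl _ ijS) /= => [|q]; last first.
  rewrite !in_zint => /andP[_ ->]; rewrite andbT => /negbTE iq.
  by rewrite /D iq mulr0.
apply: eq_big_seq => q; rewrite in_zint => /andP[iq qj].
have <- : fin_ma P X (j - q) j = B j q.
  have := @fin_ma_innovation 0 j q; rewrite add0r oppr0; apply.
  exact: le_trans iq.
have -> : D q i = c q i by rewrite /D iq.
by have -> : q - (q - i) = i by rewrite subKr.
Qed.

(** * The family biorthogonal to the process *)

Section DualBasis.
Variables m n : int.

Let eps := fin_innovation P X m.
Let a := fin_ar P X.

Definition dual_process i : T -> R[i] :=
  fun t => \sum_(k <- zint i n) (a (k - i) (m + k))^* * eps k t.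

Lemma cL2_dual_process i : cL2 P (dual_process i).
Proof. by apply: cL2_sum => k; exact: fin_innovation_cL2. Qed.

(** In the expansion along the innovations, the terms with [k > j] vanish because [eps k] is
    orthogonal to its past; what remains is [fin_arP] at [m + i] and [m + j]. *)
Lemma dual_process_biorthogonal i j : - m <= i -> - m <= j -> j <= n ->
  inner P (X j) (dual_process i) = (i == j)%:R.
Proof.
move=> mi mj jn; rewrite inner_sumr //; last by move=> k; exact: fin_innovation_cL2.
under eq_bigr do rewrite conjCK.
have [ij|ji] := leP i j; last first.
  rewrite gt_eqF // big1_seq // => k /=; rewrite in_zint => /andP[ik _].
  by rewrite fin_innovation_orth ?mulr0 // mj (lt_le_trans ji).
have ijS : (zint i j `<=` zint i n)%fset.
  by apply/fsubsetP => q; rewrite !in_zint => /andP[-> /le_trans ->].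
rewrite -(big_fset_incl _ ijS) /= => [|k]; last first.
  rewrite !in_zint => /andP[ik _]; rewrite ik /= -ltNge => jk.
  by rewrite fin_innovation_orth ?mulr0 // mj jk.
have mij : m + i <= m + j by rewrite lerD2l.
have mi0 : 0 <= m + i by rewrite addrC -lerBlDr add0r.
have <- : (m + i == m + j)%:R = (i == j)%:R :> R[i].
  by rewrite (inj_eq (addrI m)).
rewrite -(fin_arP mi0 mij) -/a [m + i]addrC [m + j]addrC big_zint_shift.
apply: eq_big_seq => k; rewrite in_zint => /andP[ik kj].
have -> : j + m - (k + m) = j - k by ring.
have -> : k + m - (i + m) = k - i by ring.
by rewrite [j + m]addrC [k + m]addrC (fin_ma_innovation j (le_trans mi ik)) mulrC.
Qed.

(** Orthonormality keeps only the innovations common to both sums, that is, [k] from [Num.max i j]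
    on. *)
Lemma inner_dual_process i j : - m <= i -> - m <= j ->
  inner P (dual_process i) (dual_process j)
  = \sum_(k <- zint (Num.max i j) n) (a (k - i) (m + k))^* * a (k - j) (m + k).
Proof.
move=> mi mj; rewrite inner_suml //; first last.
- exact: cL2_dual_process.
- by move=> k; exact: fin_innovation_cL2.
have epsE k : - m <= k -> inner P (eps k) (dual_process j)
    = if k \in zint j n then a (k - j) (m + k) else 0.
  move=> mk; rewrite inner_sumr; first last.
  - exact: fin_innovation_cL2.
  - by move=> l; exact: fin_innovation_cL2.
  rewrite (eq_big_seq (fun l => (k == l)%:R * a (l - j) (m + l))) => [|l].
    case: ifPn => [kS|kS]; first by rewrite big_fset_delta.
    rewrite big1_seq // => l /= lS; case: eqP => [kl|_]; last by rewrite mul0r.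
    by rewrite kl lS in kS.
  rewrite in_zint => /andP[jl _].
  have ml := le_trans mj jl.
  by rewrite conjCK fin_innovation_orthonormal // mulrC.
have maxS : (zint (Num.max i j) n `<=` zint i n)%fset.
  by apply/fsubsetP => q; rewrite !in_zint ge_max => /andP[/andP[-> _] ->].
rewrite -(big_fset_incl _ maxS) /= => [|k]; last first.
  rewrite !in_zint ge_max => /andP[ik kn]; rewrite ik kn /= andbT => jk.
  by rewrite epsE ?(le_trans mi) // in_zint (negbTE jk) mulr0.
apply: eq_big_seq => k; rewrite in_zint ge_max => /andP[/andP[ik jk] kn].
by rewrite epsE ?(le_trans mi) // in_zint jk kn.
Qed.

Lemma dual_process_lincomb i : - m <= i ->
  exists w, dual_process i = lincomb X (zint (- m) n) w.
Proof.
move=> mi.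
(* [choice] needs coefficients for every [k], hence a dummy value outside the range; inside it, the
   coefficients are extended by zero up to [n]. *)
have epsE k : exists c, k \in zint i n -> eps k = lincomb X (zint (- m) n) c.
  have [|] := boolP (k \in zint i n); last by exists (fun=> 0).
  rewrite in_zint => /andP[ik kn].
  have [c cE] := fin_innovation_lincomb (le_trans mi ik).
  exists (fun l => if l \in zint (- m) k then c l else 0) => _.
  have kS : (zint (- m) k `<=` zint (- m) n)%fset.
    by apply/fsubsetP => q; rewrite !in_zint => /andP[-> /le_trans ->].
  rewrite /eps cE -(lincomb_incl _ kS) => [|l _ /negbTE -> //].
  by apply: eq_lincomb => l ->.
have [c cE] := choice epsE.
exists (fun l => \sum_(k <- zint i n) (a (k - i) (m + k))^* * c k l).
apply/funext => t; rewrite lincomb_sum.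
by apply: eq_big_seq => k kS; rewrite cE.
Qed.

End DualBasis.

End FiniteInnovations.

(** * Unknowns indexed by a finite set of integers *)

Section FsetFunctions.
Variables (C : nzSemiRingType) (S : {fset int}).

(** Unknowns on the finite type of [S] become functions on [int], as [lincomb] and the matrix lemmas
    require. *)
Definition extend_ffun (alpha : {ffun S -> C}) (i : int) : C :=
  if insub i is Some p then alpha p else 0.

Lemma big_extend_ffun (alpha : {ffun S -> C}) (F : int -> C) :
  \sum_(i : S) alpha i * F (fsval i) = \sum_(i <- S) extend_ffun alpha i * F i.
Proof.
rewrite [RHS]big_seq_fsetE; apply: eq_bigr => i _.
by rewrite /extend_ffun valK.
Qed.

End FsetFunctions.

(** * The interpolation error and its variance *)

Theorem mainTheorem4 (R : realType) (d : measure_display)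
    (T : measurableType d) (P : probability T R) (X : int -> T -> R[i])
    (M : {fset int}) (m n : int)
    (X_L2 : zero_mean_L2 P X)
    (X_stat : weakly_stationary P X)
    (X_pnd : purely_nondeterministic P X)
    (M0 : 0 \notin M) (m_ge0 : 0 <= m) (n_ge0 : 0 <= n)
    (MN : (M `<=` zint (- m) n)%fset) :
  let N := zint (- m) n in
  let S := (0 |` M)%fset in
  let K := (N `\` S)%fset in
  let a := fin_ar P X in
  let eps := fin_innovation P X m in
  let A := fsmx S (fun i j => \sum_(k <- zint (Num.max i j) n)
                     (a (k - i) (m + k))^* * a (k - j) (m + k)) in
  let gamma i j := fsmx_entry (invmx (covmx P X N)) i j in
  let solves (alpha : {ffun S -> R[i]}) :=
    forall j : S, \sum_(i : S) alpha i * gamma (fsval i) (fsval j)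
                  = (0 == fsval j)%:R in
  [/\ A \in unitmx,
      (L2norm P (fun t => X 0 t - hatX P X 0 K t) ^+ 2)%:C
        = fsmx_entry (invmx A) 0 0,
      covmx P X N \in unitmx,
      exists! alpha, solves alpha
    & forall alpha, solves alpha ->
        {ae P, forall t, X 0 t - hatX P X 0 K t =
          \sum_(i : S) alpha i *
            \sum_(k <- zint (fsval i) n)
              (a (k - fsval i) (m + k))^* * eps k t}].
Proof.
move=> N S K a eps A gamma solves.
have X_cL2 j : cL2 P (X j) by case: (X_L2 j).
have X_notin j : ~ csp P X [set k | k < j] (X j) by case: (X_pnd j).
have X_def L : definite_on P X L := process_definite X_L2 X_notin (K := L).
pose Z := dual_process P X m n.
have Z_cL2 i : cL2 P (Z i) := cL2_dual_process X_L2 X_notin m n i.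
have ZX i j : i \in N -> j \in N -> inner P (Z i) (X j) = (i == j)%:R.
  rewrite !in_zint => /andP[mi _] /andP[mj jn]; rewrite inner_conj //.
  by rewrite (dual_process_biorthogonal X_L2 X_stat X_notin) // rmorph_nat.
have wP i : exists wi, i \in N -> Z i = lincomb X N wi.
  have [|] := boolP (i \in N); last by exists (fun=> 0).
  rewrite in_zint => /andP[mi _].
  by have [wi] := dual_process_lincomb X_L2 X_stat X_notin n mi; exists wi.
have [w wE] := choice wP.
pose ZZ i j := inner P (Z i) (Z j).
(* Pairing the expansion of [Z i] in the [X k] with [Z j] isolates, by biorthogonality, the
   coefficient of [X j]. *)
have ZZw i j : i \in N -> j \in N -> ZZ i j = w i j.
  move=> iN jN; rewrite /ZZ wE // inner_suml // -(big_fset_delta (w i) jN).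
  by apply: eq_big_seq => k kN; rewrite inner_conj // ZX // rmorph_nat mulrC.
(* Biorthogonality in matrix form: the Gram matrix of [Z] over [N] is the inverse covariance matrix,
   and its block over [S] will be [A]. *)
have wcov : fsmx N w *m covmx P X N = 1%:M.
  rewrite fsmx_mul -fsmx1; apply/eq_fsmx => i j iN jN.
  by rewrite -inner_suml // -ZX // wE.
have [_ cov_unit] := mulmx1_unit wcov.
have gammaE i j : i \in N -> j \in N -> gamma i j = ZZ i j.
  move=> iN jN; rewrite ZZw // /gamma -(fsmxE w iN jN); congr fsmx_entry.
  by rewrite -[RHS](mulmxK cov_unit) wcov mul1mx.
have N0 : 0 \in N by rewrite in_zint oppr_le0 m_ge0.
have SN i : i \in S -> i \in N.
  by rewrite !inE => /orP[/eqP-> //|/(fsubsetP MN)].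
have S0 : 0 \in S by rewrite !inE eqxx.
have AE : A = fsmx S ZZ.
  apply/eq_fsmx => i j /SN; rewrite in_zint => /andP[mi _] /SN.
  rewrite in_zint => /andP[mj _].
  by rewrite /ZZ (inner_dual_process X_L2 X_stat X_notin).
have ZE c : lincomb Z S c = lincomb X N (fun l => \sum_(i <- S) c i * w i l).
  apply/funext => t; rewrite lincomb_sum; apply: eq_big_seq => i /SN iN.
  by rewrite wE.
have ZcX c k : k \in N -> inner P (lincomb Z S c) (X k)
    = \sum_(i <- S) (k == i)%:R * c i.
  move=> kN; rewrite inner_suml //; apply: eq_big_seq => i /SN iN.
  by rewrite ZX // mulrC eq_sym.
have A_unit : A \in unitmx.
  (* A null combination of the [Z i] has zero coefficients in the [X l], hence zero inner products
     with the [X k]; these inner products are the [c k]. *)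
  rewrite AE; apply: gram_unitmx => // c cZ0 k kS.
  rewrite -(big_fset_delta c kS) -ZcX ?SN // ZE inner_suml //.
  rewrite big1_seq // => l /= lN; rewrite ZE in cZ0.
  by rewrite (X_def _ _ cZ0) // mul0r.
pose H := fsmx_entry (invmx A).
have HA i j : i \in S -> j \in S -> \sum_(k <- S) H i k * ZZ k j = (i == j)%:R.
  move: i j; apply/(eq_fsmx S (fun i j => \sum_(k <- S) H i k * ZZ k j)).
  by rewrite -fsmx_mul fsmx1 fsmx_entryK -AE mulVmx.
have solvesE alpha : solves alpha <-> forall j, j \in S ->
    \sum_(i <- S) extend_ffun alpha i * ZZ i j = (0 == j)%:R.
  have sumE j : j \in S -> \sum_(i <- S) extend_ffun alpha i * ZZ i j
      = \sum_(i : S) alpha i * gamma (fsval i) j.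
    move=> jS; rewrite [RHS](big_extend_ffun alpha (gamma^~ j)).
    apply: eq_big_seq => i iS.
    by rewrite gammaE ?SN.
  split=> sol j; last by rewrite -sumE ?fsvalP // sol // fsvalP.
  by move=> jS; rewrite sumE //; exact: sol [` jS]%fset.
(* The system says that [alpha] times the block over [S] is row 0 of the identity, so [alpha] is row
   0 of the inverse. *)
have solH alpha : solves alpha ->
    forall j, j \in S -> extend_ffun alpha j = H 0 j.
  move=> /solvesE sol j jS; rewrite -(big_fset_delta (H^~ j) S0).
  under eq_big_seq => k kS do rewrite -sol // mulr_suml.
  rewrite exchange_big /= -(big_fset_delta (extend_ffun alpha) jS).
  apply: eq_big_seq => i iS; rewrite eq_sym -(fsmx_mul1C HA) // mulr_suml.
  by apply: eq_bigr => k _; rewrite mulrC mulrA.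
pose alpha0 : {ffun S -> R[i]} := [ffun p => H 0 (fsval p)].
have sol0 : solves alpha0.
  apply/solvesE => j jS; rewrite -HA //; apply: eq_big_seq => i iS.
  by rewrite /extend_ffun insubT ffunE.
have errorE alpha : solves alpha -> forall t,
    X 0 t - hatX P X 0 K t = lincomb Z S (extend_ffun alpha) t.
  move=> /solvesE sol.
  (* The coefficients over [N] of [X 0] minus the proposed error. On [S] they vanish by the system,
     as [ZZ] and [w] agree, so this difference lies in the span over [K]. *)
  pose c l := (0 == l)%:R - \sum_(i <- S) extend_ffun alpha i * w i l.
  have KN : (K `<=` N)%fset by exact: fsubsetDl.
  have cE t : lincomb X K c t = X 0 t - lincomb Z S (extend_ffun alpha) t.
    rewrite (lincomb_incl X KN) => [|k kN].
      by rewrite /c lincombB lincomb_delta // ZE.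
    rewrite in_fsetD kN andbT negbK => kS; rewrite /c -sol // -sumrB big1_seq //.
    by move=> i /= /SN iN; rewrite ZZw // subrr.
  have -> : hatX P X 0 K = lincomb X K c; last by move=> t; rewrite cE subKr.
  apply: orth_proj_lincomb => // k kK.
  have -> : (fun t => X 0 t - lincomb X K c t) = lincomb Z S (extend_ffun alpha).
    by apply/funext => t; rewrite cE subKr.
  (* For [k] in [K], biorthogonality kills every term since [k] is not in [S]. *)
  move: kK; rewrite in_fsetD => /andP[kS kN]; rewrite ZcX // big1_seq //.
  move=> i /= iS; case: eqP => [ki|_]; last by rewrite mul0r.
  by rewrite ki iS in kS.
split=> //.
- rewrite sqr_L2norm (_ : (fun t => _) = lincomb Z S (extend_ffun alpha0)); last first.
    by apply/funext/errorE.
  set E := lincomb Z S _.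
  have E_cL2 : cL2 P E by exact: cL2_lincomb.
  rewrite -/(H 0 0) -(solH _ sol0) // -(big_fset_delta (extend_ffun alpha0) S0).
  (* Conjugating first leaves the outer coefficients unconjugated; the inner products of [E] with
     the [Z j] are Kronecker symbols, so only the coefficient at 0 survives. *)
  rewrite inner_conj // {2}/E inner_sumr // rmorph_sum; apply: eq_big_seq => j jS.
  rewrite inner_suml // (proj1 (solvesE _) sol0) // rmorphM /= conjCK.
  by rewrite rmorph_nat mulrC.
- exists alpha0; split=> // alpha sol; apply/ffunP => p.
  have := solH _ sol _ (fsvalP p); rewrite -(solH _ sol0 _ (fsvalP p)).
  by rewrite /extend_ffun valK.
move=> alpha sol; apply: aeW => t; rewrite (errorE _ sol).
exact/esym/(big_extend_ffun alpha (fun i => Z i t)).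
Qed.
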